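(* Let $S$ be a non-empty finite set of positive integers whose largest element is $n$. Then there is a graph $G$ with $n$ vertices such that $S$ is a pinnacle set of $G$. Furthermore, when $1 \notin S$ or $|S| = 1$, $G$ can be chosen to be a tree. Otherwise, when $1 \in S$ and $|S| \ge 2$, $G$ cannot be a connected graph (i.e., no connected graph with $n$ vertices has $S$ as a pinnacle set).
   Context: Graphs are finite and simple, and $[n] = \{1,2,\ldots,n\}$. A labeling of a graph $G$ with $n$ vertices is a bijection $\lambda : V(G) \to [n]$. The label $\lambda(u)$ of a vertex $u$ is a pinnacle of $(G,\lambda)$ if $\lambda(u) > \lambda(v)$ for every neighbor $v$ of $u$ (so the label of an isolated vertex is vacuously a pinnacle). The pinnacle set of $(G,\lambda)$ is the set of all pinnacles of $(G,\lambda)$. A subset $S \subseteq [n]$ is a pinnacle set of $G$ if there is a labeling $\lambda$ of $G$ such that $S$ is the pinnacle set of $(G,\lambda)$. *)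

(* Defs.v *)
From mathcomp Require Import all_boot finmap.

Set Implicit Arguments.
Unset Strict Implicit.
Unset Printing Implicit Defensive.

Local Open Scope fset_scope.

Record sgraph := SGraph {
  vertex :> finType;
  adj : rel vertex;
  adj_sym : symmetric adj;
  adj_irrefl : irreflexive adj
}.

Definition connected_graph (G : sgraph) : Prop :=
  0 < #|G| /\ forall u v : G, connect (@adj G) u v.

(* [ucycle] also accepts the closed walk u, v, u along one edge, presented as
   [:: u; v]; graph cycles are the ones with at least three vertices. *)
Definition acyclic_graph (G : sgraph) : Prop :=
  forall c : seq G, ucycle (@adj G) c -> size c < 3.

Definition tree (G : sgraph) : Prop := connected_graph G /\ acyclic_graph G.

(* Labels are natural numbers from 1 to #|G|, so a labeling is a function to
   [nat] that is a bijection onto that interval. *)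
Definition labeling (G : sgraph) (lam : G -> nat) : Prop :=
  injective lam /\ forall k : nat, (exists u : G, lam u = k) <-> 1 <= k <= #|G|.

Definition is_pinnacle (G : sgraph) (lam : G -> nat) (u : G) : bool :=
  [forall v : G, adj u v ==> (lam v < lam u)].

Definition pinnacles (G : sgraph) (lam : G -> nat) : {fset nat} :=
  [fset lam u | u in [set u : G | is_pinnacle lam u]].

Definition pinnacle_set (G : sgraph) (S : {fset nat}) : Prop :=
  (forall k, k \in S -> 1 <= k <= #|G|) /\
  exists lam : G -> nat, labeling lam /\ pinnacles lam = S.

(* Main.v *)
Require Import Defs.
From mathcomp Require Import all_boot finmap.

Set Implicit Arguments.
Unset Strict Implicit.
Unset Printing Implicit Defensive.

Local Open Scope fset_scope.

(** Every pinnacle set is realized by one family of graphs, with the labels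
    themselves as vertices (the ordinal [i] carries the label [i.+1]).  Each
    label outside [S] is joined to the top label [n], so it is not a pinnacle
    while [n] is one.  A label [s] of [S] below [n] is a pinnacle as soon as
    all its neighbours are smaller; it is either left isolated, which always
    works, or hung from the label 1, which works when 1 is not in [S] and gives
    a tree: a star around [n] with further leaves attached to 1.  If [S] is a
    singleton there is nothing to hang, and the graph is just the star.

    All these graphs join each vertex to its image under a map [f] (its
    parent).  Such a graph is a tree once some rank strictly decreases along
    [f] outside a single root: a vertex of maximal rank on a cycle would have
    its parent as both neighbours ([parent_graph_acyclic]), and climbing to the
    parent leads every vertex to the root ([parent_graph_connected]).

    Conversely, a connected graph with at least two vertices gives the vertex
    labelled 1 a neighbour, whose label is larger, so 1 is not a pinnacle. *)

(** * Graphs of parent maps *)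

Section ParentGraph.
Variables (T : finType) (f : T -> T).

Definition parent_adj (u v : T) : bool :=
  (u != v) && ((f u == v) || (f v == u)).

Lemma parent_adj_sym : symmetric parent_adj.
Proof. by move=> u v; rewrite /parent_adj eq_sym orbC. Qed.

Lemma parent_adj_irrefl : irreflexive parent_adj.
Proof. by move=> u; rewrite /parent_adj eqxx. Qed.

Definition parent_graph : sgraph := SGraph parent_adj_sym parent_adj_irrefl.

Variable rank : T -> nat.
Hypothesis rank_parent : forall u, f u != u -> rank (f u) < rank u.

(** A neighbour other than the parent is a child, which has larger rank. *)
Lemma adj_rank_le_parent u v : parent_adj u v -> rank v <= rank u -> v = f u.
Proof.
move=> /andP[neq_uv /orP[/eqP-> // | /eqP fv]] le_vu.
by have := @rank_parent v; rewrite fv ltnNge le_vu => /(_ neq_uv).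
Qed.

Lemma parent_graph_acyclic : acyclic_graph parent_graph.
Proof.
move=> c /andP[cyc_c uniq_c]; rewrite ltnNge; apply/negP => size_c.
have [x0 x0c] : exists x, x \in c.
  by case: c size_c {cyc_c uniq_c} => // x s _; exists x; rewrite mem_head.
have [x xc max_x] : exists2 x, x \in c & forall y, y \in c -> rank y <= rank x.
  by case: (@arg_maxnP _ x0 (mem c) rank x0c) => x xc max_x; exists x.
(* Rotating the cycle puts [x] first, next to both of its neighbours. *)
have [i s rot_c] := rot_to xc.
move: cyc_c uniq_c size_c max_x.
rewrite -(rot_cycle i) -(rot_uniq i) -(size_rot i) => cyc_c uniq_c size_c max_x.
have {}max_x y : y \in x :: s -> rank y <= rank x.
  by rewrite -rot_c mem_rot; apply: max_x.
move: cyc_c uniq_c size_c; rewrite rot_c {rot_c}.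
case/lastP: s max_x => [|s z] // max_x.
case: s max_x => [|y s] // max_x.
rewrite /= rcons_path rcons_path last_rcons => /andP[xy /andP[_ zx]].
have ->: y = f x.
  by apply: (adj_rank_le_parent xy); apply: max_x; rewrite !inE eqxx orbT.
have ->: z = f x.
  apply: adj_rank_le_parent; first by rewrite parent_adj_sym.
  by apply: max_x; rewrite !inE mem_rcons mem_head !orbT.
by rewrite mem_rcons mem_head /= andbF.
Qed.

Lemma parent_graph_connected (r : T) :
  (forall u, f u = u -> u = r) -> connected_graph parent_graph.
Proof.
move=> root_r; split; first by apply/card_gt0P; exists r.
have conn_r u : connect parent_adj u r.
  have [k] := ubnP (rank u); elim: k u => // k IHk u; rewrite ltnS => le_uk.
  have [fu|fu] := eqVneq (f u) u; first by rewrite (root_r _ fu).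
  apply: (connect_trans (connect1 (_ : parent_adj u (f u)))).
    by rewrite /parent_adj eq_sym fu eqxx.
  by apply: IHk; apply: leq_trans le_uk; apply: rank_parent.
move=> u v; apply: (connect_trans (conn_r u)).
by rewrite (sym_connect_sym parent_adj_sym).
Qed.

End ParentGraph.

(** * Realizing a prescribed pinnacle set *)

Section Realization.
Variables (S : {fset nat}) (m : nat) (a : 'I_m.+1 -> 'I_m.+1).
Hypothesis S_pos : forall k, k \in S -> 0 < k.
Hypothesis S_le : forall k, k \in S -> k <= m.+1.
Hypothesis top_in_S : m.+1 \in S.

(** The map [a] says where to hang the elements of [S] below the maximum. *)
Definition star_parent (i : 'I_m.+1) : 'I_m.+1 :=
  if (i == ord_max) || (i.+1 \notin S) then ord_max else a i.

Lemma ord_succ_labeling : labeling (G := parent_graph star_parent) (fun i => i.+1).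
Proof.
split=> [i j [/val_inj] // | k]; split=> [[i <-] | ].
  by rewrite /= card_ord ltn_ord.
rewrite /= card_ord; case: k => // k le_k.
by exists (Ordinal (le_k : k < m.+1)).
Qed.

(** An element of [S] must stay isolated ([a i = i]) or hang from a smaller
    label outside [S].  Hence no element of [S] other than the maximum is the
    parent of another vertex. *)
Hypothesis a_hang : forall i, i != ord_max -> i.+1 \in S ->
  a i = i \/ (a i < i /\ (a i).+1 \notin S).

(** The centre is larger than all its neighbours and keeps every label outside
    [S] from being a pinnacle; an element of [S] below it has no child by
    [a_hang], so its only possible neighbour is the smaller label it hangs
    from. *)
Lemma star_pinnacleE (i : 'I_m.+1) :
  is_pinnacle (G := parent_graph star_parent) (fun j => j.+1) i = (i.+1 \in S).
Proof.
apply/forallP/idP => [pin_i | iS j].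
  apply/negPn/negP => iNS; have := pin_i ord_max.
  have neq_i : i != ord_max by apply: contraNneq iNS => ->.
  by rewrite /= /parent_adj neq_i /star_parent iNS orbT eqxx /= ltnS ltnNge leq_ord.
apply/implyP => /andP[neq_ij]; rewrite ltnS.
have [i_top _|neq_i] := eqVneq i ord_max.
  by rewrite ltn_neqAle val_eqE eq_sym neq_ij i_top leq_ord.
rewrite /star_parent (negPf neq_i) iS /=.
case/orP => [/eqP ai | ].
  have [aE|[lt_ai _]] := a_hang neq_i iS; last by rewrite -ai.
  by rewrite -ai aE eqxx in neq_ij.
case: ifP => [_ | /negbT]; first by rewrite eq_sym (negPf neq_i).
rewrite negb_or negbK => /andP[neq_j jS] /eqP aj.
have [aE|[_]] := a_hang neq_j jS; first by rewrite -aj aE eqxx in neq_ij.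
by rewrite aj iS.
Qed.

Lemma star_pinnacle_set : pinnacle_set (parent_graph star_parent) S.
Proof.
split=> [k kS|]; first by rewrite /= card_ord S_pos ?S_le.
exists (fun i : 'I_m.+1 => i.+1); split; first exact: ord_succ_labeling.
apply/fsetP => k; apply/imfsetP/idP => [[i /= + ->]|kS].
  by rewrite inE star_pinnacleE.
case: k kS (S_pos kS) (S_le kS) => // k kS _ le_k.
by exists (Ordinal (le_k : k < m.+1)); rewrite //= inE star_pinnacleE.
Qed.

End Realization.

(** The ranks are 0 for the centre, 1 for the labels outside [S] and 2 for the
    leaves hung from the label 1. *)
Lemma star_tree (S : {fset nat}) (m : nat) :
    (forall i : 'I_m.+1, i != ord_max -> i.+1 \in S -> 1 \notin S) ->
  tree (parent_graph (star_parent S (fun _ : 'I_m.+1 => ord0))).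
Proof.
move=> oneNS.
pose rank (i : 'I_m.+1) := if i == ord_max then 0 else (i.+1 \in S).+1.
have rank_lt u : star_parent S (fun=> ord0) u != u ->
    rank (star_parent S (fun=> ord0) u) < rank u.
  rewrite /star_parent /rank; have [-> | neq_u] /= := eqVneq u ord_max.
    by rewrite eqxx.
  case uS: (u.+1 \in S) => /=; last by rewrite eqxx.
  by rewrite (negPf (oneNS u neq_u uS)); case: ifP.
split; last exact: parent_graph_acyclic rank_lt.
apply: (parent_graph_connected rank_lt (r := ord_max)) => u.
rewrite /star_parent; case: ifPn => [_ <- // | ].
rewrite negb_or negbK => /andP[neq_u uS] u0; have := oneNS u neq_u uS.
by move: uS; rewrite -u0 /= => ->.
Qed.

(** * The label 1 in a connected graph *)

Lemma connected_has_neighbor (G : sgraph) (u v : G) :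
  connected_graph G -> u != v -> exists w : G, adj u w.
Proof.
move=> [_ /(_ u v)/connectP[[|w p] /= ]]; first by move=> _ ->; rewrite eqxx.
by move=> /andP[uw _] _ _; exists w.
Qed.

Lemma connected_one_notin_pinnacle_set (G : sgraph) (S : {fset nat}) :
  connected_graph G -> 1 < #|G| -> pinnacle_set G S -> 1 \notin S.
Proof.
move=> conn_G card_G [_ [lam [[_ lam_onto] <-]]].
apply/negP => /imfsetP[u /=]; rewrite inE => /forallP pin_u lam_u.
have [v lam_v] : exists v, lam v = 2 by apply/lam_onto.
have neq_uv : u != v by apply/eqP => uv; rewrite -uv -lam_u in lam_v.
have [w uw] := connected_has_neighbor conn_G neq_uv.
have := pin_u w; rewrite uw -lam_u ltnS leqn0 => /eqP lam_w.
by have /lam_onto : exists x, lam x = 0 by exists w.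
Qed.

Theorem theorem2p1 (S : {fset nat}) (n : nat)
    (S_neq0 : S != fset0)
    (S_pos : forall k, k \in S -> 0 < k)
    (n_in_S : n \in S)
    (n_max : forall k, k \in S -> k <= n) :
  [/\ exists G : sgraph, #|G| = n /\ pinnacle_set G S,
      (1 \notin S \/ #|` S| = 1) ->
        exists G : sgraph, [/\ #|G| = n, tree G & pinnacle_set G S]
    & (1 \in S /\ 2 <= #|` S|) ->
        forall G : sgraph, #|G| = n -> connected_graph G -> ~ pinnacle_set G S].
Proof.
case: n n_in_S n_max => [/S_pos // | m] topS S_le; split.
- exists (parent_graph (star_parent S (id : 'I_m.+1 -> 'I_m.+1))).
  split; first exact: card_ord.
  by apply: star_pinnacle_set => // i _ _; left.
- move=> S_tree.
  have oneNS (i : 'I_m.+1) : i != ord_max -> i.+1 \in S -> 1 \notin S.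
    case: S_tree => [// | /eqP/cardfs1P[x defS]] neq_i iS.
    case/eqP: neq_i; apply: val_inj; move: iS topS.
    by rewrite defS !inE => /eqP <- /eqP[].
  exists (parent_graph (star_parent S (fun _ : 'I_m.+1 => ord0))).
  split; [exact: card_ord | exact: star_tree | ].
  apply: star_pinnacle_set => // i neq_i iS; right; split; last exact: oneNS iS.
  rewrite lt0n; apply/negP => /eqP i0.
  by have := oneNS i neq_i iS; rewrite -[X in X.+1]i0 iS.
- move=> [oneS card_S] G card_G conn_G pin_S.
  suff card_gt1 : 1 < #|G|.
    by have := connected_one_notin_pinnacle_set conn_G card_gt1 pin_S; rewrite oneS.
  rewrite card_G ltnNge; apply/negP => m0.
  have: S `<=` [fset 1].
    apply/fsubsetP => k kS; rewrite inE eqn_leq S_pos // andbT.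
    exact: leq_trans (S_le k kS) m0.
  by move/fsubset_leq_card; rewrite cardfs1 leqNgt card_S.
Qed.
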